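(* Let $a,b,c\ge 0$ be integers and let $L = \{1^a, 3^b, 6^c\}$. Consider the assertion $( * )$: $L$ has a realization if and only if $L$ is admissible (that is, the Buratti-Horak-Rosa Conjecture holds for $L$). (i) If $c$ is even and $b \geq 13 + c/2$, then $( * )$ holds. (ii) If $c$ is odd and $b \geq 18 + (c-1)/2$, then $( * )$ holds.
   Context: Multisets: exponents denote multiplicity, so $\{1^a,3^b,6^c\}$ contains $a$ copies of $1$, $b$ copies of $3$ and $c$ copies of $6$. The underlying set of a multiset is the set of its distinct elements. Realizations: $K_v$ is the complete graph on the vertex set $\{0,1,\ldots,v-1\}$. The length of the edge between $x$ and $y$ in $K_v$ is $\ell(x,y)=\min(|x-y|,\,v-|x-y|)$. A realization of a multiset $L$ of size $v-1$ is a Hamiltonian path $[h_1,\ldots,h_v]$ in $K_v$ such that the multiset $\{\ell(h_i,h_{i+1}) : 1\le i\le v-1\}$ equals $L$. Admissibility: a multiset $L$ of size $v-1$ is admissible if its underlying set is contained in $\{1,\ldots,\lfloor v/2\rfloor\}$ and for every divisor $d$ of $v$ the number of multiples of $d$ appearing in $L$ (with multiplicity) is at most $v-d$. *)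

(* Defs.v *)
From mathcomp Require Import all_boot.

Set Implicit Arguments.
Unset Strict Implicit.
Unset Printing Implicit Defensive.

(* A multiset of naturals is a [seq nat] considered up to [perm_eq]; every
   notion below is invariant under permutation of the multiset argument [L].
   The graph attached to [L] is K_v with v = |L| + 1, on the vertices
   0, ..., v - 1. *)
Definition order_of (L : seq nat) : nat := (size L).+1.

(* Subtraction is truncated, so |x - y| is written (x - y) + (y - x). *)
Definition absdiff (x y : nat) : nat := (x - y) + (y - x).

Definition edge_length (v x y : nat) : nat :=
  minn (absdiff x y) (v - absdiff x y).

(* K_v is complete, so a Hamiltonian path is any ordering of its vertices. *)
Definition hamiltonian_path (v : nat) (h : seq nat) : bool :=
  perm_eq h (iota 0 v).

Definition path_lengths (v : nat) (h : seq nat) : seq nat :=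
  if h is x :: s then pairmap (edge_length v) x s else [::].

Definition realization (L h : seq nat) : Prop :=
  hamiltonian_path (order_of L) h /\ perm_eq (path_lengths (order_of L) h) L.

Definition admissible (L : seq nat) : Prop :=
  {in L, forall x, 1 <= x <= (order_of L) %/ 2} /\
  (forall d, d %| order_of L -> count (fun x => d %| x) L <= order_of L - d).

Definition BHR_holds (L : seq nat) : Prop :=
  (exists h, realization L h) <-> admissible L.

(* The multiset {1^a, 3^b, 6^c}. *)
Definition mset136 (a b c : nat) : seq nat :=
  nseq a 1 ++ nseq b 3 ++ nseq c 6.

(* Main.v *)
Require Import Defs.
From mathcomp Require Import all_boot.
From mathcomp Require Import zify.

Set Implicit Arguments.
Unset Strict Implicit.
Unset Printing Implicit Defensive.

(** Admissibility is necessary for every multiset: if d divides v, an edge of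
    K_v joins two vertices congruent modulo d exactly when d divides its
    length, so a Hamiltonian path, which visits all d residue classes, has at
    least d - 1 lengths that d does not divide (lemma
    [residues_leq_crossings]).

    For the converse, lengths 3 and 6 are steps 1 and 2 along a progression of
    difference 3, so consider paths through the positions 0, ..., n.  The block
    +2, -1, +2 leads from x to x + 3 through x + 2 and x + 1 with two steps 2
    and one step 1.  With k such blocks, then steps +1, one gets from 0 to n
    using 2k steps 2 as soon as 3k <= n (lemma [route_zigzag]).  Beginning with
    1, 0, 2 gives one further step 2, hence the odd numbers, for a path that
    starts in 1 (lemma [route_zigzag_odd]).  Write k = floor(c/2).  A path with
    b + c edges of length 3 and 6, cut into at most three progressions, needs
    3k positions for the blocks and a bounded number lost at the cuts; this is
    available because b + c >= b + 2k and b - k is at least a constant.  Which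
    progressions are used depends on a.

    - a >= 2: on the first b + c + 3 vertices, the three residue classes
      modulo 3 are traversed up, down and up, joined by two edges of length 1.
      The order of the classes is chosen so that the path ends in the largest
      of these vertices, and the remaining a - 2 edges of length 1 lead from
      there through the remaining vertices.
    - a <= 1: admissibility at d = 3 forces 3 not to divide v, so that
      x |-> 3x permutes the integers modulo v.  A traversal of 0, ..., v - 1
      by steps 1 and 2 is mapped to a path with lengths 3 and 6, which settles
      a = 0.  If a = 1, let t be the integer among (v - 1)/3 and (v + 1)/3;
      positions at distance t modulo v become vertices at distance 1.  Go up
      through the positions 0, ..., t - 1, jump to v - 1, which is -1 modulo v
      and so is at distance t from t - 1, and go down to t. *)

(** * Necessity of admissibility *)

Lemma edge_lengthC v x y : edge_length v x y = edge_length v y x.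
Proof. by rewrite /edge_length /absdiff addnC. Qed.

Lemma edge_length_range v x y :
  x < v -> y < v -> x != y -> 1 <= edge_length v x y <= v %/ 2.
Proof. rewrite /edge_length /absdiff; lia. Qed.

(** The length is |x - y| or v - |x - y|, and d divides v. *)
Lemma dvdn_edge_length d v x y :
  d %| v -> x < v -> y < v -> d %| edge_length v x y -> x = y %[mod d].
Proof.
move=> dv; wlog lexy: x y / x <= y => [W xv yv dl|xv yv].
  case/orP: (leq_total x y) => le; first exact: W.
  by apply/esym/W; rewrite // edge_lengthC.
have -> : edge_length v x y = minn (y - x) (v - (y - x)).
  by rewrite /edge_length /absdiff (eqP lexy) add0n.
move=> dm; have dyx : d %| y - x.
  case/orP: (leq_total (y - x) (v - (y - x))) => le.
    by move: dm; rewrite (minn_idPl le).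
  by move: dm; rewrite (minn_idPr le) dvdn_subr //; lia.
by apply/esym/eqP; rewrite eqn_mod_dvd.
Qed.

(** A residue class that the path has not met before can only be entered through
    an edge whose length d does not divide. *)
Lemma residues_leq_crossings d v x s :
  d %| v -> all (ltn^~ v) (x :: s) ->
  size (undup (map (modn^~ d) (x :: s))) <=
    (count (fun l => ~~ (d %| l)) (pairmap (edge_length v) x s)).+1.
Proof.
move=> dv; elim: s x => // y s IHs x /andP[xv ysv].
have yv : y < v by case/andP: ysv.
have {IHs} := IHs y ysv; set t := map _ (y :: s); set N := count _ _ => le_t.
have -> : map (modn^~ d) (x :: y :: s) = x %% d :: t by [].
rewrite /= -/N; case: ifP => [_|/negbT xnew].
  by rewrite (leq_trans le_t) // ltnS leq_addl.
have -> : ~~ (d %| edge_length v x y).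
  apply: contra xnew => /(dvdn_edge_length dv xv yv) ->.
  exact: mem_head.
by rewrite /= add1n ltnS.
Qed.

Lemma realization_admissible L h : realization L h -> admissible L.
Proof.
case; rewrite /hamiltonian_path; set v := order_of L => hV hL.
have hv : all (ltn^~ v) h.
  by apply/allP => x; rewrite (perm_mem hV) mem_iota.
have hU : uniq h by rewrite (perm_uniq hV) iota_uniq.
split=> [l|d dv].
  rewrite -(perm_mem hL); case: h hv hU {hV hL} => // x s.
  elim: s x => //= y s IHs x /and3P[xv yv sv] /and3P[]; rewrite inE negb_or.
  case/andP=> xy _ ys us; rewrite inE => /orP[/eqP->|].
    exact: edge_length_range.
  by apply: IHs => /=; rewrite ?yv ?ys.
case: h hV hL hv {hU} => [/perm_size//|x s hV hL hv].
have := residues_leq_crossings dv hv.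
rewrite (permP hL) => le.
(* The path meets each of the d classes, since d <= v. *)
have dlev : d <= v by apply: dvdn_leq.
have ge : size (iota 0 d) <= size (undup (map (modn^~ d) (x :: s))).
  apply: uniq_leq_size (iota_uniq _ _) _ => r; rewrite mem_iota => /andP[_ rd].
  rewrite mem_undup; apply/mapP; exists r; last by rewrite modn_small.
  by rewrite (perm_mem hV) mem_iota /= add0n (leq_trans rd).
have split_L : count (dvdn d) L + count (fun l => ~~ (d %| l)) L = size L.
  exact: count_predC.
change (count (dvdn d) L <= v - d).
have dN := leq_trans ge le; rewrite size_iota in dN.
by rewrite /v /order_of -split_L -addnS -addnBA ?leq_addr.
Qed.

(** * Paths through a given multiset of vertices *)

(** The vertices [V] and the lengths [L] are multisets.  The ends [x] and [y] are
    recorded because they determine the length of the edge that joins two paths,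
    which is all that [route_cat] needs to know about them. *)
Definition route v (V : seq nat) x y (L : seq nat) : Prop :=
  exists p, [/\ perm_eq (x :: p) V, last x p = y
              & perm_eq (pairmap (edge_length v) x p) L].

Lemma route_perm v V V' x y L L' :
  perm_eq V V' -> perm_eq L L' -> route v V x y L -> route v V' x y L'.
Proof.
move=> VV' LL' [p [pV px pL]].
by exists p; split=> //; [apply: perm_trans VV'|apply: perm_trans LL'].
Qed.

Lemma route1 v x : route v [:: x] x x [::].
Proof. by exists [::]; split. Qed.

Lemma route_cat v V1 V2 x1 y1 x2 y2 L1 L2 :
  route v V1 x1 y1 L1 -> route v V2 x2 y2 L2 ->
  route v (V1 ++ V2) x1 y2 (L1 ++ edge_length v y1 x2 :: L2).
Proof.
move=> [p [pV pl pL]] [q [qV ql qL]]; exists (p ++ x2 :: q); split.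
- by rewrite -cat_cons perm_cat.
- by rewrite last_cat.
by rewrite pairmap_cat pl perm_cat //= perm_cons.
Qed.

Lemma route_rev v V x y L : route v V x y L -> route v V y x L.
Proof.
case=> p []; elim: p x V L => [|z p IHp] x V L pV /= pl pL.
  rewrite -pl; exists [::]; split=> //.
have r := IHp _ _ _ (perm_refl _) pl (perm_refl _).
have := route_cat r (route1 v x).
apply: route_perm.
  by apply: perm_trans pV; rewrite perm_catC.
by apply: perm_trans pL; rewrite perm_catC /= edge_lengthC.
Qed.

Lemma route_realization L V x y L' :
  perm_eq V (iota 0 (order_of L)) -> perm_eq L' L ->
  route (order_of L) V x y L' -> exists h, realization L h.
Proof.
move=> VV LL [p [pV _ pL]]; exists (x :: p); split.
  exact: perm_trans pV VV.
exact: perm_trans pL LL.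
Qed.

Lemma route_tail v V x y L m : 2 <= v ->
  route v V x y L -> route v (V ++ iota y.+1 m) x (y + m) (L ++ nseq m 1).
Proof.
move=> v2 rV; elim: m => [|m IHm]; first by rewrite addn0 !cats0.
have /(route_cat IHm) := route1 v (y + m.+1).
have -> : edge_length v (y + m) (y + m.+1) = 1.
  by rewrite /edge_length /absdiff; lia.
have -> : iota y.+1 m.+1 = iota y.+1 m ++ [:: y + m.+1].
  by rewrite -(addn1 m) iotaD /= addn1 addSnnS.
by rewrite -(addn1 m) nseqD -!catA.
Qed.

Lemma perm_iota_surj v V :
  size V = v -> (forall x, x < v -> x \in V) -> perm_eq V (iota 0 v).
Proof.
move=> sV inV; rewrite perm_sym.
have sub : {subset iota 0 v <= V} by move=> x; rewrite mem_iota => /inV.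
have le : size V <= size (iota 0 v) by rewrite size_iota sV.
apply: uniq_perm (iota_uniq _ _) (leq_size_uniq (iota_uniq _ _) sub le) _.
exact: (uniq_min_size (iota_uniq _ _) sub le).2.
Qed.

(** * Traversing a progression of difference 3 *)

Lemma count_cons (P : pred nat) x s : count P (x :: s) = P x + count P s.
Proof. by []. Qed.

Lemma count_mset136 P a b c :
  count P (mset136 a b c) = P 1 * a + P 3 * b + P 6 * c.
Proof. by rewrite /mset136 !count_cat !count_nseq addnA. Qed.

Lemma size_mset136 a b c : size (mset136 a b c) = a + b + c.
Proof. by rewrite /mset136 !size_cat !size_nseq addnA. Qed.

(** [f] places the positions 0, ..., n in K_v so that steps 1 and 2 between
    positions become edges of length 3 and 6. *)
Definition triple_steps v f n : Prop :=
  forall x d, d <= 2 -> x + d <= n -> edge_length v (f x) (f (x + d)) = 3 * d.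

Lemma triple_steps_shift v f m n :
  triple_steps v f (m + n) -> triple_steps v (fun x => f (m + x)) n.
Proof. by move=> fP x d d2 xd; rewrite addnA fP //; lia. Qed.

Lemma map_iota_split (f : nat -> nat) m n :
  map f (iota 0 (m + n).+1) =
  map f (iota 0 m) ++ map (fun x => f (m + x)) (iota 0 n.+1).
Proof.
rewrite -addnS iotaD map_cat add0n -[in iota m _](addn0 m) iotaDl.
by rewrite -map_comp.
Qed.

Lemma route_sweep v f n :
  triple_steps v f n ->
  route v (map f (iota 0 n.+1)) (f 0) (f n) (mset136 0 n 0).
Proof.
elim: n f => [|n IHn] f fP; first exact: route1.
have := IHn _ (@triple_steps_shift v f 1 n fP).
move/(route_cat (route1 v (f 0))).
by rewrite (map_iota_split f 1 n) /= (fP 0 1).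
Qed.

(** Each of the [k] blocks 0, 2, 1, followed by 3, costs three positions and
    contributes two lengths 6 and one length 3. *)
Lemma route_zigzag v f n k :
  triple_steps v f n -> 3 * k <= n ->
  route v (map f (iota 0 n.+1)) (f 0) (f n) (mset136 0 (n - 2 * k) (2 * k)).
Proof.
elim: k f n => [|k IHk] f n fP kn.
  by rewrite muln0 subn0; apply: route_sweep.
have {kn}[m def_n km] : exists2 m, n = 3 + m & 3 * k <= m
  by exists (n - 3); lia.
rewrite {}def_n in fP *.
have := IHk _ _ (triple_steps_shift fP) km.
move/(route_cat (route1 v (f 1))).
move/(route_cat (route1 v (f 2))).
move/(route_cat (route1 v (f 0))).
rewrite addn0 (fP 0 2) ?(fP 1 2) // (edge_lengthC v (f 2)) (fP 1 1) //.
apply: route_perm.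
  by rewrite map_iota_split perm_cons (perm_catCA [:: _] [:: _]).
apply/permP => P; rewrite !(count_mset136, cat0s, count_cons).
by case: (P 3) (P 6) => [] []; lia.
Qed.

(** The beginning 1, 0, 2 produces the lengths 3, 6 on two positions, which
    changes the parity of the number of lengths 6.  The Boolean [o] says whether
    this beginning is used, so that the path starts in position [o]. *)
Lemma route_zigzag_odd v f n k (o : bool) :
  triple_steps v f n -> 3 * k + 2 * o <= n ->
  route v (map f (iota 0 n.+1)) (f o) (f n)
    (mset136 0 (n - (2 * k + o)) (2 * k + o)).
Proof.
case: o => [|/=] fP kn; last by rewrite !addn0 in kn *; apply: route_zigzag.
have {kn}[m def_n km] : exists2 m, n = 2 + m & 3 * k <= m
  by exists (n - 2); lia.
rewrite {}def_n in fP *.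
have := route_zigzag (triple_steps_shift fP) km.
move/(route_cat (route1 v (f 0))).
move/(route_cat (route1 v (f 1))).
rewrite addn0 (fP 0 2) // edge_lengthC (fP 0 1) //.
apply: route_perm.
  by rewrite map_iota_split (perm_catCA [:: _] [:: _]).
apply/permP => P; rewrite !(count_mset136, cat0s, count_cons).
by case: (P 3) (P 6) => [] []; lia.
Qed.

(** * At least two lengths 1: the residue classes modulo 3 *)

Lemma triple_steps_class v r n :
  12 <= v -> triple_steps v (fun x => 3 * x + r) n.
Proof. by move=> v12 x d d2 _; rewrite /edge_length /absdiff; lia. Qed.

Definition residue_class r n := map (fun x => 3 * x + r) (iota 0 n.+1).

Lemma mem_residue_class r n x :
  x %% 3 = r -> x %/ 3 <= n -> x \in residue_class r n.
Proof.
move=> xr xn; apply/mapP; exists (x %/ 3); first by rewrite mem_iota.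
by rewrite -xr mulnC -divn_eq.
Qed.

(** Class [p] is traversed upwards, then [q] downwards, then [r] upwards: the edge
    lengths in the hypotheses are those between the tops of [p] and [q] and
    between the bottoms of [q] and [r].  The start of the path is not joined to
    anything, so that it can be moved to realize an odd number of lengths 6. *)
Lemma route_three_classes v p q r np nq nr k (o : bool) :
  12 <= v -> k + 2 <= np -> k + 2 <= nq -> k + 2 <= nr ->
  edge_length v (3 * np + p) (3 * nq + q) = 1 -> edge_length v q r = 1 ->
  route v (residue_class p np ++ residue_class q nq ++ residue_class r nr)
    (3 * o + p) (3 * nr + r)
    (mset136 2 (np + nq + nr - (2 * k + o)) (2 * k + o)).
Proof.
move=> v12 kp kq kr pq qr.
have step_class s n := @triple_steps_class v s n v12.
(* k is the sum of the floors of k/3, (k + 1)/3 and (k + 2)/3. *)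
have rp := @route_zigzag_odd v _ _ (k %/ 3) o (step_class p np) ltac:(lia).
have rq := @route_zigzag v _ _ ((k + 1) %/ 3) (step_class q nq) ltac:(lia).
have rr := @route_zigzag v _ _ ((k + 2) %/ 3) (step_class r nr) ltac:(lia).
have := route_cat rp (route_cat (route_rev rq) rr).
rewrite muln0 !add0n pq qr; apply: route_perm => //.
apply/permP => P; rewrite !(count_mset136, count_cat, count_cons).
by case: (P 1) (P 3) (P 6) => [] [] []; lia.
Qed.

Lemma realization_two_ones a b c :
  2 <= a -> c %/ 2 + 11 <= b -> exists h, realization (mset136 a b c) h.
Proof.
move=> a2 bc; set k := c %/ 2 in bc; set o := odd c.
have cE : c = 2 * k + o by rewrite /k /o; lia.
set v := order_of (mset136 a b c).
have vE : v = a + b + c + 1 by rewrite /v /order_of size_mset136 addn1.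
have v12 : 12 <= v by lia.
(* The classes are taken below w; n r is the last index in the class of r, and
   the class that contains w - 1 has to come last. *)
pose w := b + c + 3; pose n r := (w - 1 - r) %/ 3.
have [p [q [r [res pq qr top]]]] : exists p q r,
    [/\ [&& p < 3, q < 3, r < 3, p != q, p != r & q != r],
       edge_length v (3 * n p + p) (3 * n q + q) = 1, edge_length v q r = 1 &
       3 * n r + r = w - 1].
  have : w %% 3 < 3 by rewrite ltn_mod.
  case E : (w %% 3) => [|[|[|//]]] _;
    [exists 0, 1, 2|exists 2, 1, 0|exists 2, 0, 1].
  - by rewrite /edge_length /absdiff /n; split => //; lia.
  - by rewrite /edge_length /absdiff /n; split => //; lia.
  by rewrite /edge_length /absdiff /n; split => //; lia.
have kn x : x < 3 -> k + 2 <= n x by rewrite /n /w; lia.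
have sum_n : n p + n q + n r = b + c by rewrite /n; lia.
have [kp kq kr] : [/\ k + 2 <= n p, k + 2 <= n q & k + 2 <= n r].
  by split; apply: kn; lia.
have := route_three_classes o v12 kp kq kr pq qr.
rewrite sum_n -cE addnK top.
move/(@route_tail _ _ _ _ _ (a - 2) (leq_trans _ v12)) => /(_ isT).
apply: route_realization.
  apply: perm_iota_surj => [|x xv].
    by rewrite !size_cat !size_map !size_iota; lia.
  rewrite !mem_cat mem_iota; case: (ltnP x w) => [xw|wx]; last by lia.
  have x_class y : y < 3 -> x %% 3 = y -> x \in residue_class y (n y).
    by move=> y3 xy; apply: mem_residue_class; rewrite // /n; lia.
  have /or3P[/eqP E|/eqP E|/eqP E] :
    [|| x %% 3 == p, x %% 3 == q | x %% 3 == r] by lia.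
  - by rewrite (x_class p) //; lia.
  - by rewrite (x_class q) ?orbT //; lia.
  by rewrite (x_class r) ?orbT //; lia.
apply/permP => P; rewrite !(count_mset136, count_cat, count_nseq).
by case: (P 1); lia.
Qed.

(** * At most one length 1: multiplication by 3 modulo v *)

(** Reduction modulo v replaces a difference 3d by v - 3d or leaves it, and either
    way the length is 3d, since 6d <= 12 <= v. *)
Lemma triple_steps_mod v n :
  12 <= v -> triple_steps v (fun x => (3 * x) %% v) n.
Proof.
move=> v12 x d d2 _; rewrite mulnDr -modnDml.
set u := _ %% v; have uv : u < v by rewrite ltn_mod; lia.
have -> : (u + 3 * d) %% v = if u + 3 * d < v then u + 3 * d else u + 3 * d - v.
  case: ltnP => ud; first exact: modn_small.
  by rewrite -[in LHS](subnK ud) modnDr modn_small; lia.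
by rewrite /edge_length /absdiff; case: ltnP; lia.
Qed.

Lemma perm_iota_mul3 v :
  ~~ (3 %| v) -> perm_eq (map (fun x => (3 * x) %% v) (iota 0 v)) (iota 0 v).
Proof.
move=> v3; apply: perm_iota_surj => [|x xv].
  by rewrite size_map size_iota.
(* As 3 does not divide v, one of x, v + x and 2v + x is a multiple of 3. *)
have [y [j [yv xE]]] : exists y j, y < v /\ 3 * y = j * v + x.
  have /or3P[E|E|E] : [|| 3 %| x, 3 %| v + x | 3 %| 2 * v + x] by lia.
  - by exists (x %/ 3), 0; lia.
  - by exists ((v + x) %/ 3), 1; lia.
  by exists ((2 * v + x) %/ 3), 2; lia.
apply/mapP; exists y; first by rewrite mem_iota.
by rewrite xE modnMDl modn_small.
Qed.

Lemma realization_one_one b c :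
  ~~ (3 %| b + c + 2) -> c %/ 2 + 11 <= b ->
  exists h, realization (mset136 1 b c) h.
Proof.
move=> v3 bc; set k := c %/ 2 in bc; set o := odd c.
have cE : c = 2 * k + o by rewrite /k /o; lia.
set v := order_of (mset136 1 b c).
have vE : v = b + c + 2 by rewrite /v /order_of size_mset136; lia.
rewrite -vE in v3; have v12 : 12 <= v by lia.
(* The arcs are 0, ..., m and m + 1, ..., m + 1 + n, so that m + 1 is t. *)
have [m [n [vmn jump]]] : exists m n,
    v = m + n + 2 /\ (3 * m.+1 == v + 1) || (3 * m.+1 == v - 1).
  exists ((v + 1) %/ 3 - 1), (v - (v + 1) %/ 3 - 1); lia.
have fP := @triple_steps_mod v (m.+1 + n) v12.
have gP := @triple_steps_mod v m v12.
have rA := route_zigzag_odd (k := k %/ 3) (o := o) gP ltac:(lia).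
have rB := route_zigzag (k := k - k %/ 3) (triple_steps_shift fP) ltac:(lia).
have := route_cat rA (route_rev rB).
rewrite -map_iota_split.
have -> : edge_length v ((3 * m) %% v) ((3 * (m.+1 + n)) %% v) = 1.
  (* The two ends are the vertices 3t - 3, which is v - 2 or v - 4, and v - 3. *)
  have -> : 3 * m %% v = 3 * m by rewrite modn_small; lia.
  have -> : (3 * (m.+1 + n)) %% v = v - 3.
    have -> : 3 * (m.+1 + n) = 2 * v + (v - 3) by lia.
    by rewrite modnMDl modn_small; lia.
  by rewrite /edge_length /absdiff; lia.
apply: route_realization.
  have -> : (m.+1 + n).+1 = v by lia.
  exact: perm_iota_mul3.
apply/permP => P; rewrite !(count_mset136, count_cat, count_cons).
by case: (P 1) (P 3) (P 6) => [] [] []; lia.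
Qed.

Lemma realization_no_one b c :
  ~~ (3 %| b + c + 1) -> c %/ 2 + 11 <= b ->
  exists h, realization (mset136 0 b c) h.
Proof.
move=> v3 bc; set k := c %/ 2 in bc; set o := odd c.
have cE : c = 2 * k + o by rewrite /k /o; lia.
set v := order_of (mset136 0 b c).
have vE : v = b + c + 1 by rewrite /v /order_of size_mset136; lia.
rewrite -vE in v3; have v12 : 12 <= v by lia.
have fP := @triple_steps_mod v (b + c) v12.
have := route_zigzag_odd (k := k) (o := o) fP ltac:(lia).
apply: route_realization; last by rewrite -cE addnK.
have -> : (b + c).+1 = v by lia.
exact: perm_iota_mul3.
Qed.

(** * The conjecture for {1^a, 3^b, 6^c} with b large *)

(** Among the conditions of admissibility only the one for d = 3 excludes a
    multiset here: when 3 divides v it forces a >= 2. *)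
Lemma BHR_holds_mset136 a b c : c %/ 2 + 11 <= b -> BHR_holds (mset136 a b c).
Proof.
move=> bc; split=> [[h]|[_ adm]]; first exact: realization_admissible.
have few : 2 <= a \/ ~~ (3 %| (a + b + c).+1).
  case: (boolP (3 %| _)) => v3; last by right.
  have := adm 3; rewrite /order_of size_mset136 count_mset136 => /(_ v3).
  by rewrite /= => le; left; lia.
case: a {adm} few => [|[|a]] few.
- by apply: realization_no_one => //; case: few; lia.
- by apply: realization_one_one => //; case: few; lia.
exact: realization_two_ones.
Qed.

Theorem lemma5p2 (a b c : nat) :
  (~~ odd c -> 13 + c %/ 2 <= b -> BHR_holds (mset136 a b c)) /\
  (odd c -> 18 + (c - 1) %/ 2 <= b -> BHR_holds (mset136 a b c)).
Proof. by split=> oc bc; apply: BHR_holds_mset136; lia. Qed.
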